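(* Let $(S,+)$ be a Clifford semigroup. Let $\mathbb{WB}^+$ be the set of all weak left braces $(S,+,\cdot)$ with the given addition $+$, and let $\mathbb{GF}$ be the set of all Gamma functions on $(S,+)$. For $(S,+,\cdot)\in\mathbb{WB}^+$ let $\mathcal{G}(S)$ be the map $x\mapsto\lambda_x$, where $\lambda_x(y)=-x+xy$. For $\gamma\in\mathbb{GF}$ let $\mathcal{B}(\gamma)=(S,+,\circ)$, where $x\circ y=x+\gamma_x(y)$. Then $\mathcal{G}:\mathbb{WB}^+\to\mathbb{GF}$ and $\mathcal{B}:\mathbb{GF}\to\mathbb{WB}^+$ are mutually inverse bijections, under which dual weak left braces correspond to dual Gamma functions.
   Context: A semigroup $(S,+)$ (not necessarily commutative) is an inverse semigroup if for each $a\in S$ there is a unique element $-a$ with $a-a+a=a$ and $-a+a-a=-a$; for an inverse semigroup $(S,\cdot)$ written multiplicatively this element is written $a^{-1}$. $E(S,+)$ is the set of idempotents. An inverse semigroup $(S,+)$ is a Clifford semigroup if $-a+a=a-a$ for all $a$; then $a^0:=-a+a=a-a$. $\mathrm{End}(S,+)$ is the semigroup of semigroup endomorphisms of $(S,+)$ under composition $fg=f\circ g$. A weak left brace is a triple $(S,+,\cdot)$ with $(S,+)$ and $(S,\cdot)$ inverse semigroups such that $x(y+z)=xy-x+xz$ and $xx^{-1}=-x+x$ for all $x,y,z\in S$. It is a dual weak left brace if moreover $(S,\cdot)$ is a Clifford semigroup. A map $\gamma:S\to\mathrm{End}(S,+)$, $x\mapsto\gamma_x$, is a Gamma function on $(S,+)$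 if for all $x,y\in S$: (F1) $\gamma_x\gamma_y=\gamma_{x+\gamma_x(y)}$, $\gamma_{x^0}(x)=x$ and $x^0+\gamma_x(y)=\gamma_x(y)$; (F2) if $\gamma_x(x)=x^0$, then $x=x^0$; (F3) there exists $x^{-1}\in S$ such that $\gamma_x(x^{-1})=-x$ and $\gamma_{x^{-1}}(x)=-x^{-1}$; (F4) if $e,f\in E(S,+)$, then $\gamma_e(f)=e+f$. Let $H_x=\{a\in S\mid a^0=x^0\}$, a subgroup of $(S,+)$ with identity $x^0$. A map $\gamma:S\to\mathrm{End}(S,+)$ is a dual Gamma function on $(S,+)$ if for all $x,y\in S$: (D1) $\gamma_x|_{H_x}$ is an automorphism of the group $(H_x,+)$; (D2) $\gamma_x\gamma_y=\gamma_{x+\gamma_x(y)}$ and $x^0+\gamma_x(y)=\gamma_x(y)$; (D3) if $e,f\in E(S,+)$, then $\gamma_e(f)=e+f$. (Every dual Gamma function is a Gamma function.) *)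

(* Defs.v *)
From mathcomp Require Import all_boot.
From mathcomp Require Import boolp classical_sets functions.

Set Implicit Arguments.
Unset Strict Implicit.
Unset Printing Implicit Defensive.

Local Open Scope classical_set_scope.

Section InverseSemigroups.
Variables (S : Type) (op : S -> S -> S) (inv : S -> S).

Definition is_inverse (a b : S) : Prop :=
  op (op a b) a = a /\ op (op b a) b = b.

(* [inv] is determined by [op], so it carries no extra data. *)
Definition inverse_semigroup : Prop :=
  associative op /\ forall a, unique (is_inverse a) (inv a).

Definition clifford_semigroup : Prop :=
  inverse_semigroup /\ forall a, op (inv a) a = op a (inv a).

Definition idempotents : set S := [set e | op e e = e].

Definition is_endomorphism (f : S -> S) : Prop :=
  forall a b, f (op a b) = op (f a) (f b).

Definition is_automorphism_on (H : set S) (f : S -> S) : Prop :=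
  set_bij H H f /\ forall a b, H a -> H b -> f (op a b) = op (f a) (f b).

End InverseSemigroups.

Section WeakBraces.
Variables (S : Type) (add : S -> S -> S) (opp : S -> S).

Local Notation "x + y" := (add x y).
Local Notation "- x" := (opp x).
Local Notation "x - y" := (add x (opp y)).

Definition zero_of (a : S) : S := - a + a.

Definition weak_left_brace (mul : S -> S -> S) (inv : S -> S) : Prop :=
  [/\ inverse_semigroup add opp,
      inverse_semigroup mul inv,
      forall x y z, mul x (y + z) = mul x y - x + mul x z
    & forall x, mul x (inv x) = - x + x].

Definition dual_weak_left_brace (mul : S -> S -> S) (inv : S -> S) : Prop :=
  weak_left_brace mul inv /\ clifford_semigroup mul inv.

(* A brace with additive structure (S, +) is recorded by its multiplication. *)
Definition weak_left_braces : set (S -> S -> S) :=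
  [set mul | exists inv, weak_left_brace mul inv].

Definition dual_weak_left_braces : set (S -> S -> S) :=
  [set mul | exists inv, dual_weak_left_brace mul inv].

(* Products of endomorphisms follow the convention f g = f \o g. *)
Definition gamma_functions : set (S -> S -> S) :=
  [set gamma |
    [/\ forall x, is_endomorphism add (gamma x),
        forall x y,
          [/\ gamma x \o gamma y = gamma (x + gamma x y),
              gamma (zero_of x) x = x
            & zero_of x + gamma x y = gamma x y],
        forall x, gamma x x = zero_of x -> x = zero_of x,
        forall x, exists y, gamma x y = - x /\ gamma y x = - y
      & forall e f, idempotents add e -> idempotents add f ->
          gamma e f = e + f]].

Definition component (x : S) : set S := [set a | zero_of a = zero_of x].

Definition dual_gamma_functions : set (S -> S -> S) :=
  [set gamma |
    [/\ forall x, is_endomorphism add (gamma x),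
        forall x, is_automorphism_on add (component x) (gamma x),
        forall x y,
          gamma x \o gamma y = gamma (x + gamma x y) /\
          zero_of x + gamma x y = gamma x y
      & forall e f, idempotents add e -> idempotents add f ->
          gamma e f = e + f]].

Definition gamma_of_brace (mul : S -> S -> S) : S -> S -> S :=
  fun x y => - x + mul x y.

Definition brace_of_gamma (gamma : S -> S -> S) : S -> S -> S :=
  fun x y => x + gamma x y.

End WeakBraces.

(* Main.v *)
(* The idempotents of a Clifford semigroup (S, +) are central and x^0 + x = x.
   In a weak left brace x y absorbs x^0, which makes x y = x + lambda_x(y), and
   sums and products of idempotents agree; this gives (F1)-(F4).  Conversely
   (F3) provides inverses for x o y = x + gamma_x(y), and by (F2) and (F4) its
   idempotents are those of + and commute, so that inverses are unique.
   The brace is dual exactly when x and x^-1 lie in the same component H_x;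
   then lambda_(x^-1) inverts lambda_x on H_x. *)
Require Import Defs.
From mathcomp Require Import all_boot.
From mathcomp Require Import boolp classical_sets functions.

Set Implicit Arguments.
Unset Strict Implicit.
Unset Printing Implicit Defensive.

Local Open Scope classical_set_scope.

(** * Inverse semigroups: products and commutation of idempotents *)

Section InverseSemigroup.
Variables (S : Type) (op : S -> S -> S) (inv : S -> S).
Local Notation "x * y" := (op x y).

Lemma is_inverse_sym a b : is_inverse op a b -> is_inverse op b a.
Proof. by case. Qed.

Lemma is_inverse_idem (e : S) : idempotents op e -> is_inverse op e e.
Proof. by move=> ee; split; rewrite ee ee. Qed.

(** If [b] and [c] are both inverse to [a], then [b = c a b] because [b a] and [c a] commute, and
    [b = b a c] because [a b] and [a c] commute. Hence [c = c a c = c a b a c = b a c = b]. *)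
Lemma inverse_semigroup_of_commuting_idempotents :
  associative op -> (forall a, is_inverse op a (inv a)) ->
  (forall e f, idempotents op e -> idempotents op f -> e * f = f * e) ->
  inverse_semigroup op inv.
Proof.
move=> opA invP idC; split=> // a; split=> // c [aca cac].
move: (inv a) (invP a) => b [aba bab].
have iab : idempotents op (a * b) by rewrite /idempotents /= opA aba.
have iac : idempotents op (a * c) by rewrite /idempotents /= opA aca.
have iba : idempotents op (b * a) by rewrite /idempotents /= opA bab.
have ica : idempotents op (c * a) by rewrite /idempotents /= opA cac.
have bE : b = c * a * b.
  rewrite -{1}bab -{1}aca !opA -[b * a * c * a]opA (idC _ _ iba ica).
  by rewrite -(opA (c * a)) bab.
have bE' : b = b * a * c.
  rewrite -{1}bab -{1}aca -!opA [a * (c * _)]opA (idC _ _ iac iab).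
  by rewrite !opA bab.
by rewrite -cac -{1}aba !opA -bE -bE'.
Qed.

Hypothesis invS : inverse_semigroup op inv.

Lemma inverse_opA : associative op. Proof. exact: invS.1. Qed.
Let opA := inverse_opA.

Lemma mulVK a : a * inv a * a = a. Proof. exact: (invS.2 a).1.1. Qed.
Lemma mulKV a : inv a * a * inv a = inv a. Proof. exact: (invS.2 a).1.2. Qed.

Lemma inv_unique a b : is_inverse op a b -> inv a = b.
Proof. exact: (invS.2 a).2. Qed.

Lemma invK a : inv (inv a) = a.
Proof. by apply: inv_unique; split; rewrite ?mulVK ?mulKV. Qed.

Lemma inv_idem (e : S) : idempotents op e -> inv e = e.
Proof. by move=> /is_inverse_idem/inv_unique. Qed.

Lemma idem_mulV a : idempotents op (a * inv a).
Proof. by rewrite /idempotents /= opA mulVK. Qed.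

Lemma idem_mulVl a : idempotents op (inv a * a).
Proof. by rewrite /idempotents /= opA mulKV. Qed.

(** With [x] the inverse of [e f], the element [f x e] is also inverse to [e f], so [x = f x e] by
    uniqueness. This makes [x] idempotent, hence self-inverse, and so equal to [e f]. *)
Lemma idem_mul e f :
  idempotents op e -> idempotents op f -> idempotents op (e * f).
Proof.
move=> ee ff; set x := inv (e * f).
have [efx xef] : is_inverse op (e * f) x := (invS.2 _).1.
have xE : x = f * x * e.
  apply: inv_unique; split.
    by rewrite -[RHS]efx !opA -(opA e f f) ff -(opA _ e e) ee.
  rewrite !opA -[f * x * e * e]opA ee -[f * x * e * f * f]opA ff.
  by rewrite -[in RHS]xef !opA.
have xx : idempotents op x.
  by rewrite /idempotents /= {1 2}xE [RHS]xE -[in RHS]xef !opA.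
by rewrite -(inv_unique (is_inverse_sym (conj efx xef))) inv_idem.
Qed.

(** The product [f e] is an inverse of the idempotent [e f], which is its own inverse. *)
Lemma idemC e f : idempotents op e -> idempotents op f -> e * f = f * e.
Proof.
move=> ee ff; have efi := idem_mul ee ff; have fei := idem_mul ff ee.
rewrite -(inv_idem efi); apply: inv_unique; split.
  by rewrite !opA -(opA e f f) ff -(opA _ e e) ee -opA efi.
by rewrite !opA -(opA f e e) ee -(opA _ f f) ff -opA fei.
Qed.

Lemma invM a b : inv (a * b) = inv b * inv a.
Proof.
have C := idemC (idem_mulV b) (idem_mulVl a).
apply: inv_unique; split.
  transitivity (a * (b * inv b * (inv a * a)) * b); first by rewrite !opA.
  by rewrite C !opA mulVK -!opA [b * _]opA mulVK.
transitivity (inv b * (inv a * a * (b * inv b)) * inv a); first by rewrite !opA.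
by rewrite -C !opA mulKV -!opA [inv a * _]opA mulKV.
Qed.

End InverseSemigroup.

(** * Clifford semigroups: central idempotents, endomorphisms and components *)

Section Clifford.
Variables (S : Type) (add : S -> S -> S) (opp : S -> S).
Hypothesis hS : clifford_semigroup add opp.

Local Notation "x + y" := (add x y).
Local Notation "- x" := (opp x).
Local Notation "x - y" := (add x (opp y)).
Local Notation z := (zero_of add opp).

Let hI : inverse_semigroup add opp := hS.1.
Let addA : associative add := inverse_opA hI.

Lemma zeroE a : a - a = z a. Proof. by rewrite -hS.2. Qed.
Lemma add0 a : z a + a = a. Proof. by rewrite -zeroE (mulVK hI). Qed.
Lemma addr0 a : a + z a = a. Proof. by rewrite addA (mulVK hI). Qed.
Lemma add0N a : z a - a = - a. Proof. by rewrite (mulKV hI). Qed.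
Lemma zeroN a : z (- a) = z a.
Proof. by rewrite /zero_of (invK hI) hS.2. Qed.
Lemma idem_zero a : idempotents add (z a). Proof. exact: (idem_mulVl hI). Qed.
Lemma zero_idem e : idempotents add e -> z e = e.
Proof. by move=> ee; rewrite /zero_of (inv_idem hI ee). Qed.
Lemma zero_zero a : z (z a) = z a.
Proof. exact: zero_idem (idem_zero a). Qed.

(** The Clifford law for [e + a] equates [- a + e + a] with [e + z a]; adding [a] on the left gives
    the claim. *)
Lemma idem_central e a : idempotents add e -> e + a = a + e.
Proof.
move=> ee; have eC := idemC hI ee (idem_zero a).
have zE : - a + e + a = e + z a.
  transitivity (z (e + a)).
    by rewrite /zero_of (invM hI) (inv_idem hI ee) !addA -[- a + e + e]addA ee.
  rewrite -(zeroE (e + a)) (invM hI) (inv_idem hI ee) [LHS]addA.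
  rewrite -[e + a - a]addA zeroE.
  by rewrite eC -addA ee.
have <- : a + (e + z a) = a + e by rewrite eC addA addr0.
by rewrite -zE !addA zeroE -eC -addA add0.
Qed.

Lemma addN0 a : - a + z a = - a.
Proof. by rewrite -(zeroN a) addr0. Qed.

Section Endomorphism.
Variables (f : S -> S) (fD : is_endomorphism add f).

Lemma endo_opp a : f (- a) = - f a.
Proof.
apply/esym/(inv_unique hI).
by split; rewrite -!fD ?(mulVK hI) ?(mulKV hI).
Qed.

Lemma endo_zero a : f (z a) = z (f a).
Proof. by rewrite fD endo_opp. Qed.

Lemma endo_component x a :
  f (z x) = z x -> component add opp x a -> component add opp x (f a).
Proof. by move=> fx ax; rewrite /component /= -endo_zero ax. Qed.

End Endomorphism.

Lemma component_refl x : component add opp x x. Proof. by []. Qed.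
Lemma component_zero x : component add opp x (z x).
Proof. exact: zero_zero. Qed.
Lemma component_opp x a : component add opp x a -> component add opp x (- a).
Proof. by rewrite /component /= zeroN. Qed.

(** * From weak left braces to Gamma functions *)

Section BraceToGamma.
Variables (mul : S -> S -> S) (inv : S -> S).
Hypothesis hB : weak_left_brace add opp mul inv.
Local Notation "x * y" := (mul x y).
Local Notation lam := (gamma_of_brace add opp mul).

Let hM : inverse_semigroup mul inv. Proof. by case: hB. Qed.
Let mulA : associative mul := inverse_opA hM.
Let mulD x y w : x * (y + w) = x * y - x + x * w. Proof. by case: hB. Qed.
Let mulV x : x * inv x = z x. Proof. by case: hB. Qed.

Lemma brace_mulVl x : inv x * x = z (inv x).
Proof. by rewrite -mulV (invK hM). Qed.

Lemma brace_idempotents e : idempotents mul e <-> idempotents add e.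
Proof.
split=> ee.
  have <- : e * inv e = e by rewrite (inv_idem hM ee).
  by rewrite mulV; exact: idem_zero.
by rewrite -(zero_idem ee) -mulV; exact: (idem_mulV hM).
Qed.

(** Distributivity applied to [y = y + z y] exhibits a summand [- x] in [x * y], and this summand
    absorbs the central idempotent [z x]. *)
Lemma brace_zero_add x y : z x + x * y = x * y.
Proof.
have xyE : x * y = x * y - x + x * z y by rewrite -mulD addr0.
rewrite (idem_central _ (idem_zero x)) {1}xyE -[LHS]addA.
rewrite -(idem_central _ (idem_zero x)) addA.
by rewrite -[x * y - x + z x]addA addN0 -xyE.
Qed.

Lemma add_lambda x y : x + lam x y = x * y.
Proof. by rewrite /gamma_of_brace addA zeroE brace_zero_add. Qed.

Lemma brace_of_gamma_of_brace : brace_of_gamma add lam = mul.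
Proof.
by apply/funext => x; apply/funext => y; exact: add_lambda.
Qed.

Lemma lambda_endo x : is_endomorphism add (lam x).
Proof. by move=> a b; rewrite /gamma_of_brace mulD !addA. Qed.

Lemma lambda_comp x y : lam x \o lam y = lam (x + lam x y).
Proof.
rewrite add_lambda; apply/funext => w /=; rewrite {2}/gamma_of_brace.
rewrite lambda_endo (endo_opp (@lambda_endo x)) /gamma_of_brace (invM hI) (invK hI).
rewrite mulA.
(* After expansion, [- (x * y)] and [x * (y * w)] are separated only by [x - x], which the former
   absorbs. *)
have N : - (x * y) + z x = - (x * y).
  by rewrite -{2}(brace_zero_add x y) (invM hI) (inv_idem hI (idem_zero x)).
by rewrite !addA -[_ + x - x]addA zeroE N.
Qed.

(** Put [g = e + f], idempotent for both operations. Expanding [g = g * g] gives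
    [g * e + g + g * f]. Both products equal [e * f], which absorbs [e] and [f]. *)
Lemma mul_idem e f : idempotents add e -> idempotents add f -> e * f = e + f.
Proof.
move=> ee ff; have eM := (brace_idempotents e).2 ee.
have fM := (brace_idempotents f).2 ff.
have C := idemC hM eM fM.
have efi : idempotents add (e * f).
  by apply/brace_idempotents; exact: (idem_mul hM).
have abs_e : e + e * f = e * f.
  by rewrite -{1}(zero_idem ee) brace_zero_add.
have abs_f : f + e * f = e * f.
  by rewrite C -{1}(zero_idem ff) brace_zero_add.
have He : e * (e + f) = e * f.
  by rewrite mulD eM (inv_idem hI ee) ee abs_e.
have Hf : f * (e + f) = e * f.
  by rewrite mulD fM -addA -/(z f) (zero_idem ff) -C -(idem_central _ ff).
have gi : idempotents add (e + f) := idem_mul hI ee ff.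
have gM := (brace_idempotents _).2 gi.
rewrite -[RHS]gM mulD (inv_idem hI gi) -(idemC hM eM gM) -(idemC hM fM gM).
by rewrite He Hf -addA -[e + f + _]addA abs_f abs_e efi.
Qed.

Lemma gamma_of_brace_gamma : gamma_functions add opp lam.
Proof.
split.
- exact: lambda_endo.
- move=> x y; split; first exact: lambda_comp.
    rewrite /gamma_of_brace (inv_idem hI (idem_zero x)) -{2}mulV (mulVK hM).
    exact: add0.
  by rewrite /gamma_of_brace addA add0N.
(* Adding [x] turns the hypothesis of (F2) into [x * x = x]. *)
- move=> x /(congr1 (add x)); rewrite addr0 /gamma_of_brace addA zeroE.
  by rewrite brace_zero_add => /brace_idempotents /zero_idem.
- move=> x; exists (inv x); rewrite /gamma_of_brace mulV brace_mulVl.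
  by rewrite !addN0.
- move=> e f ee ff; rewrite /gamma_of_brace (inv_idem hI ee).
  by rewrite (mul_idem ee ff) addA ee.
Qed.

Lemma dual_brace_dual_gamma :
  clifford_semigroup mul inv -> dual_gamma_functions add opp lam.
Proof.
move=> [_ hC]; have [G0 G1 _ _ G4] := gamma_of_brace_gamma.
have zV x : z (inv x) = z x by rewrite -brace_mulVl hC mulV.
(* Here [z x] equals [inv x * x], so [x * z x = x]. Fixing [z x] is what makes [lam x] preserve the
   component of [x]. *)
have lamz x : lam x (z x) = z x.
  by rewrite /gamma_of_brace -{1}mulV -hC mulA (mulVK hM).
have lamC x a : component add opp x a -> component add opp x (lam x a).
  exact (endo_component (@lambda_endo x) (lamz x)).
have lamVC x a : component add opp x a -> component add opp x (lam (inv x) a).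
  rewrite /component /= -(zV x).
  exact (endo_component (@lambda_endo (inv x)) (lamz (inv x))).
have id0 x a : component add opp x a -> lam (z x) a = a.
  by move=> <-; case: (G1 a a).
have lamM x y a : lam x (lam y a) = lam (x * y) a.
  by rewrite -add_lambda -lambda_comp.
have VK x a : component add opp x a -> lam (inv x) (lam x a) = a.
  by move=> xa; rewrite lamM brace_mulVl zV id0.
have KV x a : component add opp x a -> lam x (lam (inv x) a) = a.
  by move=> xa; rewrite lamM mulV id0.
split=> //.
- move=> x; split; last by move=> a b _ _; exact: lambda_endo.
  split.
  + exact: lamC.
  + move=> a b; rewrite !inE => xa xb ab.
    by rewrite -(VK x a xa) ab VK.
  + by move=> a xa; exists (lam (inv x) a); [exact: lamVC | exact: KV].
- by move=> x y; have [? _ ?] := G1 x y.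
Qed.

Lemma dual_gamma_dual_brace :
  dual_gamma_functions add opp lam -> clifford_semigroup mul inv.
Proof.
move=> [_ D1 D2 D3]; split; first exact: hM.
(* The endomorphism [lam x] sends [z x] to an idempotent in the component of [x], and [z x] is the
   only one. *)
have mulz x : x * z x = x.
  have H : component add opp x (lam x (z x)).
    by have [[+ _ _] _] := D1 x; apply; exact: component_zero.
  have E : z (lam x (z x)) = lam x (z x).
    by rewrite -(endo_zero (@lambda_endo x)) zero_zero.
  by rewrite -add_lambda -E H addr0.
(* This is [z (inv x) <= z x] in the order of idempotents; the same fact for [inv x] gives equality,
   which is the Clifford law. *)
have le x : z (inv x) + z x = z (inv x).
  rewrite -(mul_idem (idem_zero _) (idem_zero _)) -brace_mulVl -mulA.
  by rewrite mulz.
move=> x; rewrite brace_mulVl mulV -(le x) -[in RHS](invK hM x) -(le (inv x)).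
by rewrite (invK hM) (idem_central _ (idem_zero _)).
Qed.

End BraceToGamma.

(** * From Gamma functions to weak left braces *)

Section GammaToBrace.
Variable gamma : S -> S -> S.

Section Gamma.
Hypothesis hG : gamma_functions add opp gamma.
Local Notation mul := (brace_of_gamma add gamma).

Lemma gamma_of_brace_of_gamma : gamma_of_brace add opp mul = gamma.
Proof.
have [_ G1 _ _ _] := hG; apply/funext => x; apply/funext => y.
by rewrite /gamma_of_brace /brace_of_gamma addA; case: (G1 x y).
Qed.

Lemma brace_of_gamma_brace : weak_left_braces add opp mul.
Proof.
have [G0 G1 G2 G3 G4] := hG.
have [inv invP] := boolp.choice G3.
have mulA : associative mul.
  move=> x y w; rewrite /brace_of_gamma G0 addA.
  by have [<- _ _] := G1 x y.
have mulV x : mul x (inv x) = z x.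
  by rewrite /brace_of_gamma (invP x).1 zeroE.
have Vmul x : mul (inv x) x = z (inv x).
  by rewrite /brace_of_gamma (invP x).2 zeroE.
have zmul x : mul (z x) x = x.
  by rewrite /brace_of_gamma; have [_ -> _] := G1 x x; exact: add0.
(* Adding [- e] to [e + gamma e e = e] leaves [gamma e e = z e], the hypothesis of (F2). *)
have idem e : idempotents mul e -> idempotents add e.
  move=> /(congr1 (add (- e))); rewrite /brace_of_gamma addA.
  have [_ _ ->] := G1 e e; move=> /G2 ->; exact: idem_zero.
exists inv; split=> //.
  apply: inverse_semigroup_of_commuting_idempotents => //.
    by move=> a; split; rewrite ?mulV ?Vmul zmul.
  move=> e f /idem ee /idem ff; rewrite /brace_of_gamma !G4 // !addA ee ff.
  exact: idem_central.
move=> x y w; rewrite /brace_of_gamma G0 !addA.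
rewrite -[x + gamma x y - x + x]addA -/(z x) -[_ + z x + _]addA.
by have [_ _ ->] := G1 x w.
Qed.

End Gamma.

Lemma dual_gamma_gamma :
  dual_gamma_functions add opp gamma -> gamma_functions add opp gamma.
Proof.
move=> [G0 D1 D2 D3].
have stab x a : component add opp x a -> component add opp x (gamma x a).
  by have [[+ _ _] _] := D1 x; apply.
have inj x a b : component add opp x a -> component add opp x b ->
    gamma x a = gamma x b -> a = b.
  by have [[_ + _] _] := D1 x; move=> H xa xb; apply: H; rewrite inE.
have gM x y a : gamma x (gamma y a) = gamma (x + gamma x y) a.
  by rewrite -(D2 x y).1.
have G00 x : gamma (z x) (z x) = z x.
  by rewrite (D3 _ _ (idem_zero x) (idem_zero x)); exact: idem_zero.
(* By (D2) and (D3), [gamma (z x)] composed with itself is [gamma (z x)]; being injective on the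
   component, it is the identity there. *)
have id0 x : gamma (z x) x = x.
  have xx : component add opp (z x) x by rewrite /component /= zero_zero.
  apply: (inj (z x)) => //; first exact: stab.
  by rewrite gM G00 (idem_zero x).
have G0z x : gamma x (z x) = z x.
  have H := stab x _ (component_zero x).
  by rewrite -[RHS]H -(endo_zero (G0 x)) zero_zero.
split=> //.
- by move=> x y; split=> //; have [] := D2 x y.
- move=> x xx; apply: (inj x) => //; first exact: component_zero.
  by rewrite xx G0z.
(* The witness for (F3) is the preimage of [- x] in the component. The second equation is checked
   after applying [gamma x], since [gamma x \o gamma y = gamma (x - x) = gamma (z x)]. *)
- move=> x; have [[_ _ surj] _] := D1 x.
  have [y xy yE] := surj (- x) (component_opp (component_refl x)).
  exists y; split=> //.
  apply: (inj x).
  + rewrite /component /= -xy; apply: stab; rewrite /component /=.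
    by rewrite xy.
  + exact: component_opp.
  + by rewrite gM yE zeroE id0 (endo_opp (G0 x)) yE (invK hI).
Qed.

End GammaToBrace.

End Clifford.

(** * The mutually inverse bijections and their restriction to the dual case *)

Theorem proposition3p13 (S : Type) (add : S -> S -> S) (opp : S -> S)
    (hS : clifford_semigroup add opp) :
  [/\ set_bij (weak_left_braces add opp) (gamma_functions add opp)
        (gamma_of_brace add opp),
      set_bij (gamma_functions add opp) (weak_left_braces add opp)
        (brace_of_gamma add),
      {in weak_left_braces add opp,
        cancel (gamma_of_brace add opp) (brace_of_gamma add)},
      {in gamma_functions add opp,
        cancel (brace_of_gamma add) (gamma_of_brace add opp)}
    & gamma_of_brace add opp @` dual_weak_left_braces add opp
        = dual_gamma_functions add opp /\
      brace_of_gamma add @` dual_gamma_functions add opp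
        = dual_weak_left_braces add opp].
Proof.
set WB := weak_left_braces add opp; set GF := gamma_functions add opp.
set G := gamma_of_brace add opp; set B := brace_of_gamma add.
have GK mul : WB mul -> B (G mul) = mul.
  by move=> [inv /(brace_of_gamma_of_brace hS)].
have BK gamma : GF gamma -> G (B gamma) = gamma.
  exact: gamma_of_brace_of_gamma.
have GP mul : WB mul -> GF (G mul).
  by move=> [inv /(gamma_of_brace_gamma hS)].
have BP gamma : GF gamma -> WB (B gamma) by exact: brace_of_gamma_brace.
have GD mul : dual_weak_left_braces add opp mul ->
    WB mul /\ dual_gamma_functions add opp (G mul).
  move=> [inv [hB hC]]; split; first by exists inv.
  exact: dual_brace_dual_gamma hB hC.
have BD gamma : dual_gamma_functions add opp gamma ->
    GF gamma /\ dual_weak_left_braces add opp (B gamma).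
  move=> hD; have hG := dual_gamma_gamma hS hD; split=> //.
  have [inv hB] := BP _ hG; exists inv; split=> //.
  (* The criterion concerns the lambda map of [B gamma], which is [gamma] itself. *)
  by apply: (dual_gamma_dual_brace hS hB); rewrite -/G BK.
split.
- split=> // [m m' | gamma hG].
    by rewrite !inE => hm hm' e; rewrite -(GK m hm) e GK.
  by exists (B gamma); [exact: BP | exact: BK].
- split=> // [g g' | mul hm].
    by rewrite !inE => hg hg' e; rewrite -(BK g hg) e BK.
  by exists (G mul); [exact: GP | exact: GK].
- by move=> mul; rewrite inE; exact: GK.
- by move=> gamma; rewrite inE; exact: BK.
- split; apply/seteqP; split.
  + by move=> _ [mul /GD [_ ?] <-].
  + by move=> gamma /BD [hG hB]; exists (B gamma); last exact: BK.
  + by move=> _ [gamma /BD [_ ?] <-].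
  + by move=> mul /GD [hB hG]; exists (G mul); last exact: GK.
Qed.
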